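(* Let $r\in(0,1)$ and let $k\geq 1$ be an integer. Let $W_1,W_2,\dots$ be i.i.d.\ copies of a positive random variable $W$ with $\mathbb{E}[W]=1$ (an i.i.d.\ multiplicative cascade with scale ratio $r$), with scaling exponents $\zeta_p$ defined by $\mathbb{E}[W^p]=r^{\zeta_p}$ (so $\zeta_0=0$) and incremental exponents $\delta_p=\zeta_{p+k}-\zeta_p$. Suppose the hierarchical symmetry axiom A1 holds: there exists $\beta\in(0,1)$ such that $\delta_\infty=\lim_{p\to\infty}\delta_p$ exists and is finite and $$\delta_{p+k}=(1-\beta)\delta_\infty+\beta\,\delta_p\qquad\text{for all }p\in k\mathbb{N}_0=\{0,k,2k,\dots\}.$$ Set $\gamma=\delta_\infty/k$ and $C=(\delta_0-\delta_\infty)/(1-\beta)$. Then: (i) $\zeta_p=\gamma p+C\bigl(1-\beta^{p/k}\bigr)$. (ii) $W$ is uniquely determined to be log-Poisson: $\log W=a+bN$ with $N\sim\mathrm{Poisson}(\lambda)$, where $a=\gamma\ln r$, $b=(\ln\beta)/k$, $\lambda=-C\ln r$. No other probability distribution on $W$ is compatible with A1. (iii) Let $d$ be the spatial dimension of the cascade support and let $f(h)=\inf_{p}\,[ph-\zeta_p+d]$ be the singularity spectrum. Then $$f(h)=d-C+Cx(1-\ln x),\qquad x=\frac{k(h-\gamma)}{C|\ln\beta|},$$ for $h\in[\gamma,\ \gamma+(C/k)|\ln\beta|]$.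
   Context: $\log$ and $\ln$ denote the natural logarithm. The scaling exponents are equivalently the exponents of the structure functions $S_p(\ell)=\langle|\Phi(\ell)|^p\rangle=\ell^{\zeta_p}$ of the cascade observable at scales $\ell=r^n$. *)

(* Defs.v *)
From HB Require Import structures.
From mathcomp Require Import all_boot all_order all_algebra.
From mathcomp Require Import all_classical all_reals all_analysis.
Set Implicit Arguments. Unset Strict Implicit. Unset Printing Implicit Defensive.
Import Order.TTheory GRing.Theory Num.Def Num.Theory numFieldTopology.Exports numFieldNormedType.Exports.
Local Open Scope classical_set_scope.
Local Open Scope ring_scope.

Definition incr_exp {R : realType} (zeta : R -> R) (k : nat) (p : R) : R :=
  zeta (p + k%:R) - zeta p.

Definition sing_spectrum {R : realType} (zeta : R -> R) (d h : R) : R :=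
  inf [set p * h - zeta p + d | p in [set p : R | 0 <= p]].

(* Main.v *)
(** The recursion gives [zeta (n k) = gamma n k + C (1 - beta ^+ n)], so that
    [V = (W exp (- a)) ^ k] has integer moments
    [E[V ^ n] = exp (- lambda (1 - beta ^+ n))
              = sum_j q_j (beta ^+ j) ^ n]
    with [q] the Poisson weights.  The law of [V] is recovered without any
    general moment theorem, by peeling off its atoms from the top: if
    [int_D X ^ n] converges to [L] then [X <= 1] almost everywhere on [D], and
    by dominated convergence [P (D /\ X = 1) = L].  Applied to
    [X = V / beta ^+ j] on the event [D] that [V] is none of [1], ...,
    [beta ^+ (j - 1)], this yields [P (V = beta ^+ j) = q_j]; the case [j = 0]
    also forces [lambda >= 0].  As the [q_j] sum to 1, this is the whole law of
    [W]; integrating [W ^ p] against it gives [zeta p] for all real [p >= 0],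
    and the spectrum is an elementary Legendre transform. *)
Require Import Defs.
From HB Require Import structures.
From mathcomp Require Import all_boot all_order all_algebra.
From mathcomp Require Import all_classical all_reals all_analysis measurable_realfun.
From mathcomp Require Import ring lra.
Import Order.TTheory GRing.Theory Num.Def Num.Theory numFieldTopology.Exports numFieldNormedType.Exports.
Local Open Scope classical_set_scope.
Local Open Scope ring_scope.

(** * Tails of the exponential series *)

Section expR_remainder.
Context {R : realType}.
Implicit Types x y : R.

Lemma series_exp_coeff_le_expR x n : 0 <= x -> series (exp_coeff x) n <= expR x.
Proof.
move=> x0; apply: nondecreasing_cvgn_le; last exact: is_cvg_series_exp_coeff.
by apply: nondecreasing_series => i _ _; exact: exp_coeff_ge0.
Qed.

(** Since [x <= 1], each tail term [x ^+ i / i!] with [i >= n] is at most [x ^+ n / i!], and the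
    [1 / i!] sum to at most [expR 1]. *)
Lemma expR_remainder_le x n : 0 <= x <= 1 ->
  expR x - series (exp_coeff x) n <= x ^+ n * expR 1.
Proof.
move=> /andP[x0 x1]; rewrite lerBlDl.
apply: limr_le; first exact: is_cvg_series_exp_coeff.
near=> N.
have nN : (n <= N)%N by near: N; exact: nbhs_infty_ge.
rewrite -lerBlDl sub_series_geq//.
apply: (@le_trans _ _ (x ^+ n * \sum_(n <= k < N) exp_coeff 1 k)).
  rewrite mulr_sumr; apply: ler_sum_nat => i /andP[ni _].
  rewrite /exp_coeff/= expr1n mulrA mulr1 ler_wpM2r ?invr_ge0//.
  by rewrite ler_wiXn2l.
rewrite ler_wpM2l ?exprn_ge0// -sub_series_geq//.
rewrite lerBlDr (le_trans (series_exp_coeff_le_expR _ N ler01))// lerDl.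
by apply: sumr_ge0 => i _; exact: exp_coeff_ge0.
Unshelve. all: by end_near. Qed.

(** The leading term of the tail is [(l * b ^+ m) ^+ j / j!]; the division isolates its coefficient
    and leaves an error of order [b ^+ m]. This limit becomes the mass of the [j]-th atom. *)
Lemma cvg_expR_remainder (l b : R) j : 0 <= l -> 0 < b < 1 ->
  (expR (l * b ^+ m) - series (exp_coeff (l * b ^+ m)) j) / b ^+ m ^+ j
    @[m --> \oo] --> exp_coeff l j.
Proof.
move=> l0 /andP[b0 b1].
have bn : b ^+ m @[m --> \oo] --> 0 by apply: cvg_expr; rewrite gtr0_norm.
have lbn : l * b ^+ m @[m --> \oo] --> 0.
  by rewrite -(mulr0 l); apply: cvgM => //; exact: cvg_cst.
apply: (@squeeze_cvgr _ _ _ _ (cst (exp_coeff l j))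
  (fun m => exp_coeff l j + l ^+ j.+1 * expR 1 * b ^+ m)); last first.
- rewrite -[X in _ --> X]addr0 -(mulr0 (l ^+ j.+1 * expR 1)).
  by apply: cvgD; [exact: cvg_cst|apply: cvgM => //; exact: cvg_cst].
- exact: cvg_cst.
near=> m.
have lb1 : l * b ^+ m <= 1.
  by near: m; exact: (cvgr_le _ lbn).
have lb0 : 0 <= l * b ^+ m by rewrite mulr_ge0// exprn_ge0// ltW.
have bm0 : 0 < b ^+ m ^+ j by rewrite !exprn_gt0.
have E : exp_coeff (l * b ^+ m) j = exp_coeff l j * b ^+ m ^+ j.
  by rewrite /exp_coeff/= exprMn mulrAC.
have := series_exp_coeff_le_expR _ j.+1 lb0.
have := expR_remainder_le _ j.+1 (introT andP (conj lb0 lb1)).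
rewrite seriesSr E lerBlDl => h1 h2.
rewrite ler_pdivlMr// ler_pdivrMr//; apply/andP; split.
  by rewrite lerBrDl.
rewrite lerBlDl (le_trans h1)// mulrDl addrA lerD2l.
by rewrite exprMn [b ^+ m ^+ j.+1]exprS mulrAC !mulrA mulrAC.
Unshelve. all: by end_near. Qed.

End expR_remainder.

(** * Mass at 1 read off the limit of moments *)

Section peeling.
Context d (T : measurableType d) (R : realType) (P : probability T R).
Local Open Scope ereal_scope.

(** Markov's inequality for [X ^+ n]: for [c > 1], the part of [D] where [c <= X] has mass at most
    [u n / c ^+ n], eventually below [(L + 1) / c ^+ n], which tends to 0. *)
Lemma measure_gt1_moments (D : set T) (X : T -> R) (u : R^nat) (L : R) :
    measurable D -> measurable_fun setT X -> (forall t, (0 <= X t)%R) ->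
    (forall n, \int[P]_(t in D) (X t ^+ n)%:E = (u n)%:E) ->
    u @ \oo --> L ->
  P (D `&` [set t | (1 < X t)%R]) = 0.
Proof.
move=> mD mX X0 Xu uL.
have mXc (c : R) : measurable [set t | (c <= X t)%R].
  by rewrite -[X in measurable X]setTI; exact: measurable_fun_le.
have null (c : R) : (1 < c)%R -> P (D `&` [set t | (c <= X t)%R]) = 0.
  move=> c1; set A := _ `&` _.
  have mA : measurable A by exact: measurableI.
  apply/eqP; rewrite -measure_le0.
  have c0 : (0 < c)%R by apply: lt_trans c1.
  have cvg0 : ((L + 1) * c^-1 ^+ n)%:E @[n --> \oo] --> 0.
    apply/cvg_EFin; first by near=> n.
    rewrite -[X in _ --> X](mulr0 (L + 1)%R); apply: cvgM; first exact: cvg_cst.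
    by apply: cvg_expr; rewrite gtr0_norm ?invr_gt0// invf_lt1.
  apply: (cvge_to_ge cvg0); near=> n.
  rewrite exprVn EFinM lee_pdivlMr ?exprn_gt0//.
  apply: (@le_trans _ _ (\int[P]_(t in D) (X t ^+ n)%:E)); last first.
    rewrite Xu lee_fin; near: n.
    by apply: (cvgr_le _ uL); rewrite ltrDl.
  rewrite muleC -integral_cst//.
  apply: (@le_trans _ _ (\int[P]_(t in A) (X t ^+ n)%:E)).
    apply: ge0_le_integral => //=.
    - by move=> t _; rewrite lee_fin exprn_ge0// ltW.
    - by apply/measurable_EFinP; apply: measurable_funTS; exact: measurable_funX.
    - by move=> t [_ /= ct]; rewrite lee_fin lerXn2r// nnegrE// ltW.
  apply: ge0_subset_integral => //=.
  - by apply/measurable_EFinP; apply: measurable_funTS; exact: measurable_funX.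
  - by move=> t _; rewrite lee_fin exprn_ge0.
  - by move=> t [].
have -> : D `&` [set t | (1 < X t)%R] =
    \bigcup_n (D `&` [set t | (1 + n.+1%:R^-1 <= X t)%R]).
  apply/seteqP; split => t.
    move=> [Dt /= /ltr_add_invr[n nX]]; exists n => //; split => //=.
    exact: ltW.
  move=> [n _ [Dt /= nX]]; split => //=.
  by apply: lt_le_trans nX; rewrite ltrDl.
apply/negligibleP.
  by apply: bigcup_measurable => n _; exact: measurableI.
apply: negligible_bigcup => n; apply/negligibleP; first exact: measurableI.
by apply: null; rewrite ltrDl.
Unshelve. all: by end_near. Qed.

Lemma measure_eq1_moments (D : set T) (X : T -> R) (u : R^nat) (L : R) :
    measurable D -> measurable_fun setT X -> (forall t, (0 <= X t)%R) ->
    (forall n, \int[P]_(t in D) (X t ^+ n)%:E = (u n)%:E) ->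
    u @ \oo --> L ->
  P (D `&` [set t | X t = 1%R]) = L%:E.
Proof.
move=> mD mX X0 Xu uL.
have mX1 : measurable [set t | X t = 1%R].
  by rewrite -[X in measurable X]setTI; exact: (mX measurableT _ (measurable_set1 1%R)).
have ae1 : {ae P, forall t, D t -> (X t <= 1)%R}.
  exists (D `&` [set t | (1 < X t)%R]); split.
  - apply: measurableI => //; rewrite -preimage_itvoy -[X in measurable X]setTI.
    exact: mX.
  - exact: measure_gt1_moments uL.
  - by move=> t /= /not_implyP[Dt /negP]; rewrite -ltNge.
have cvgE (v : R^nat) (l : R) :
    v @ \oo --> l -> (v n)%:E @[n --> \oo] --> l%:E.
  by move=> vl; apply/cvg_EFin => //; near=> n.
have [|||||_ _] := @dominated_convergence _ _ _ P D mD
  (fun n t => (X t ^+ n)%:E) (fun t => (\1_[set t | X t = 1%R] t)%:E) (cst 1).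
- by move=> n; apply/measurable_EFinP/measurable_funTS/measurable_funX.
- by apply/measurable_EFinP; exact: measurable_funTS.
- apply: filterS ae1 => t X1 Dt.
  apply: cvgE; have [Xt1|Xt1] := eqVneq (X t) 1%R.
    rewrite indicE mem_set//= Xt1.
    by apply: cvg_near_cst; near=> n; rewrite expr1n.
  rewrite indicE memNset/=; last exact/eqP.
  by apply: cvg_expr; rewrite ger0_norm// lt_neqAle Xt1 X1.
- exact: finite_measure_integrable_cst.
- apply: filterS ae1 => t X1 n Dt.
  by rewrite /= lee_fin ger0_norm ?exprn_ge0// exprn_ile1// X1.
rewrite integral_indic// setIC => XP.
apply: (cvg_unique _ XP) => //.
rewrite (_ : [sequence _]_n = EFin \o u); first exact: cvgE.
by apply/funext => n; exact: Xu.
Unshelve. all: by end_near. Qed.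

End peeling.

(** * Atoms of a variable with the moments of [b ^+ N], [N] Poisson *)

Section poisson_moments.
Context d (T : measurableType d) (R : realType) (P : probability T R).
Variables (V : T -> R) (l b : R).
Hypotheses (mV : measurable_fun setT V) (V0 : forall t, 0 <= V t).
Hypothesis b01 : 0 < b < 1.
Hypothesis momentV :
  forall n, (\int[P]_t (V t ^+ n)%:E = (expR (- l * (1 - b ^+ n)))%:E)%E.

Let b0 : 0 < b. Proof. by case/andP: b01. Qed.

Let E j := [set t | V t = b ^+ j].

Let mE j : measurable (E j).
Proof.
by rewrite -[X in measurable X]setTI; exact: (mV measurableT _ (measurable_set1 _)).
Qed.

Let E_inj i j t : E i t -> E j t -> i = j.
Proof.
rewrite /E/= => -> /ieexprIn; apply => //.
by rewrite lt_eqF//; case/andP: b01.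
Qed.

Let D j := ~` \bigcup_(i in `I_j) E i.

Let mD j : measurable (D j).
Proof. by apply: measurableC; exact: bigcup_measurable. Qed.

Let D0 : D 0 = setT.
Proof. by rewrite /D II0 bigcup_set0 setC0. Qed.

Let DE j : D j = D j.+1 `|` E j.
Proof.
apply/seteqP; split => t.
  move=> Dt; have [Et|Et] := pselect (E j t); first by right.
  left => -[i/=]; rewrite ltnS leq_eqVlt => /predU1P[->//|ij Eit].
  by apply: Dt; exists i.
move=> [Dt [i /= ij Eit]|Et [i /= ij Eit]].
  by apply: Dt; exists i => //=; exact: ltnW.
by rewrite (E_inj _ _ _ Eit Et) ltnn in ij.
Qed.

Let disjDE j : [disjoint D j.+1 & E j].
Proof.
apply/eqP/seteqP; split => // t [Dt Et].
by apply: Dt; exists j => /=.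
Qed.

Let mVX n (A : set T) : measurable_fun A (fun t => (V t ^+ n)%:E).
Proof. by apply/measurable_EFinP/measurable_funTS/measurable_funX. Qed.

(** The moments tend to [expR (- l)], which is therefore the probability of [V = 1] and cannot
    exceed 1. *)
Lemma poisson_moments_ge0 : 0 <= l.
Proof.
have := @measure_eq1_moments _ _ _ P setT V _ (expR (- l))
  measurableT mV V0 momentV.
rewrite setTI => /(_ _)/wrap[].
  apply: continuous_cvg; first exact: continuous_expR.
  rewrite -[X in _ --> X]mulr1; apply: cvgM; first exact: cvg_cst.
  rewrite -[X in _ --> X]subr0; apply: cvgB; first exact: cvg_cst.
  by apply: cvg_expr; rewrite gtr0_norm//; case/andP: b01.
move=> P1; have := probability_le1 P (mE 0).
by rewrite /E expr0 P1 lee_fin expR_le1 oppr_le0.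
Qed.

(* Once the atoms above [b ^+ j] are removed, [V / b ^+ j] has bounded moments
   whose limit is the mass of the next atom. *)
Let atom j :
  (forall n, \int[P]_(t in D j) (V t ^+ n)%:E
    = (expR (- l) * (expR (l * b ^+ n)
                     - series (exp_coeff (l * b ^+ n)) j))%:E)%E ->
  P (E j) = (exp_coeff l j * expR (- l))%:E.
Proof.
move=> IH.
have -> : E j = D j `&` [set t | V t / b ^+ j = 1].
  have bj : b ^+ j != 0 by rewrite expf_neq0// gt_eqF.
  apply/seteqP; split => t.
    by move=> Et; split; [rewrite DE; right|rewrite /= Et divff].
  by move=> [_ /= /eqP]; rewrite -subr_eq0 -[X in _ - X](divff bj) -mulrBl
    mulf_eq0 invr_eq0 (negPf bj) orbF subr_eq0 => /eqP.
(* The moments of [V / b ^+ j], with [(b ^+ j) ^+ n] written as [(b ^+ n) ^+ j] to match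
   [cvg_expR_remainder]. *)
apply: (@measure_eq1_moments _ _ _ _ _ _ (fun n => expR (- l) *
  ((expR (l * b ^+ n) - series (exp_coeff (l * b ^+ n)) j) / b ^+ n ^+ j))) => //.
- exact: measurable_funM.
- by move=> t; rewrite divr_ge0// exprn_ge0// ltW.
- move=> n; under eq_integral do rewrite expr_div_n mulrC EFinM.
  rewrite ge0_integralZl_EFin//=.
  + rewrite IH -EFinM (exprAC b j n).
    by rewrite mulrC mulrA.
  + by move=> t _; rewrite lee_fin exprn_ge0.
  + by rewrite invr_ge0 !exprn_ge0// ltW.
- rewrite mulrC; apply: cvgM; first exact: cvg_cst.
  exact: (cvg_expR_remainder _ _ _ poisson_moments_ge0).
Qed.

(** Induction interleaved with [atom]: the formula on [D j] for all [n] gives the mass of [E j],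
    whose contribution is then subtracted to reach [D j.+1]. *)
Let moment_D j n :
  (\int[P]_(t in D j) (V t ^+ n)%:E
    = (expR (- l) * (expR (l * b ^+ n)
                     - series (exp_coeff (l * b ^+ n)) j))%:E)%E.
Proof.
elim: j n => [n|j IH n].
  rewrite D0 momentV /series/= big_geq// subr0 -expRD.
  by congr (expR _)%:E; ring.
have := IH n; rewrite DE ge0_integral_setU//=; last first.
  by move=> t _; rewrite lee_fin exprn_ge0.
rewrite [X in (_ + X)%E](_ : _ = (b ^+ j ^+ n * (exp_coeff l j * expR (- l)))%:E).
  (* The sum is finite, so the integral over [D j.+1] is a real number and the atom's term can be
     cancelled. *)
  case: (\int[P]_(t in D j.+1) _)%E => [v| |]//; rewrite -EFinD => -[vE].
  congr EFin; apply: (addIr (b ^+ j ^+ n * (exp_coeff l j * expR (- l)))).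
  rewrite vE seriesSr /exp_coeff/= exprMn (exprAC b j n).
  by ring.
rewrite EFinM -(atom _ IH) -integral_cst//.
by apply: eq_integral => t; rewrite inE => ->.
Qed.

Lemma poisson_moments_atom j :
  P [set t | V t = b ^+ j] = (exp_coeff l j * expR (- l))%:E.
Proof. exact: atom (moment_D j). Qed.

End poisson_moments.

(** * Poisson probabilities as series *)

Section exponential_series.
Context {R : realType}.

Lemma nneseries_exp_coeff (x : R) : 0 <= x ->
  (\sum_(0 <= j <oo) (exp_coeff x j)%:E = (expR x)%:E)%E.
Proof.
move=> x0; rewrite /expR -EFin_lim; last exact: is_cvg_series_exp_coeff.
by apply/congr_lim/funext => n /=; rewrite /series/= sumEFin.
Qed.

Lemma poisson_prob_series (l : R) n (U : set nat) : 0 <= l ->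
  poisson_prob l n U
  = (\sum_(0 <= j <oo) (\1_U j * (exp_coeff l j * expR (- l)))%:E)%E.
Proof.
move=> l0; rewrite /poisson_prob; have [l_gt0|] := ltP 0 l.
  rewrite -{1}(set_mem_set U) -nneseries_esum; last first.
    by move=> j _; rewrite lee_fin poisson_pmf_ge0.
  rewrite eseries_mkcond; apply: eq_eseriesr => j _.
  rewrite /poisson_pmf l_gt0 indicE; case: (j \in U).
    by rewrite mul1r.
  by rewrite mul0r.
(* At rate 0, [poisson_prob] is the Dirac mass at 0; the series agrees because [0 ^+ 0 = 1] leaves
   only its first term. *)
move=> l_le0; have -> : l = 0 by apply/eqP; rewrite eq_le l_le0.
rewrite nneseries_recl//; last first.
  by move=> j _; rewrite lee_fin !mulr_ge0// exp_coeff_ge0.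
rewrite eseries0 ?adde0; last first.
  by move=> [|j]//= _ _; rewrite /exp_coeff/= expr0n !(mul0r, mulr0).
by rewrite /exp_coeff/= oppr0 expR0 fact0 divr1 !mulr1 diracE indicE.
Qed.

End exponential_series.

(** * Laws carried by countably many atoms *)

Section discrete_law.
Context d (T : measurableType d) (R : realType) (P : probability T R).
Variables (Y : T -> R) (x q : nat -> R).
Hypotheses (mY : measurable_fun setT Y) (x_inj : injective x).
Hypothesis atomY : forall j, P [set t | Y t = x j] = (q j)%:E.
Hypothesis q1 : (\sum_(0 <= j <oo) (q j)%:E = 1)%E.
Local Open Scope ereal_scope.

(** As the masses sum to 1, the complement of the atoms is null; on each atom the integrand is
    constant. *)
Lemma ge0_integral_discrete_law (f : R -> R) :
    measurable_fun setT f -> (forall y, (0 <= f y)%R) ->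
  \int[P]_t (f (Y t))%:E = \sum_(0 <= j <oo) (f (x j) * q j)%:E.
Proof.
move=> mf f0; pose E j := [set t | Y t = x j].
have mE j : measurable (E j).
  rewrite -[X in measurable X]setTI.
  exact: (mY measurableT _ (measurable_set1 _)).
have tE : trivIset setT E.
  apply/trivIsetP => i j _ _ /eqP ij; apply/seteqP; split => // t [/= Yi Yj].
  by apply: ij; apply: x_inj; rewrite -Yi.
have mUE : measurable (\bigcup_j E j) by exact: bigcup_measurable.
have mfY (A : set T) : measurable_fun A (fun t => (f (Y t))%:E).
  by apply/measurable_EFinP/measurable_funTS/measurableT_comp.
have fY0 t : 0 <= (f (Y t))%:E by rewrite lee_fin.
have null : P (~` \bigcup_j E j) = 0.
  rewrite probability_setC// measure_bigcup//.
  rewrite (eq_eseriesl (Q := xpredT)); last by move=> j; rewrite in_setT.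
  by rewrite (eq_eseriesr (fun j _ => atomY j)) q1 subee.
rewrite (ge0_negligible_integral (measurableC mUE) _ _ _ null)//.
rewrite setTD setCK ge0_integral_bigcup//.
apply: eq_eseriesr => j _; rewrite EFinM -atomY -integral_cst; last exact: mE.
by apply: eq_integral => t; rewrite inE => /= ->.
Qed.

Lemma discrete_law (A : set R) : measurable A ->
  P (Y @^-1` A) = \sum_(0 <= j <oo) (\1_[set n | A (x n)] j * q j)%:E.
Proof.
move=> mA; have mYA : measurable (Y @^-1` A).
  by rewrite -[X in measurable X]setTI; exact: mY.
rewrite -[X in P X]setIT -integral_indic//.
by rewrite -(ge0_integral_discrete_law (\1_A)).
Qed.

End discrete_law.

(** * The hierarchy recursion on multiples of [k] *)

Section hierarchical_exponents.
Context {R : realType}.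
Variables (zeta : R -> R) (k : nat) (beta delta_inf : R).

Let delta0 := incr_exp zeta k 0.
Let gamma := delta_inf / k%:R.
Let C := (delta0 - delta_inf) / (1 - beta).

(** The increments obey an affine recursion with fixed point [delta_inf] and ratio [beta];
    telescoping them sums a geometric series, whence the denominator [1 - beta] of [C]. *)
Lemma hierarchical_exponents_lattice : (0 < k)%N -> beta < 1 -> zeta 0 = 0 ->
  (forall n, incr_exp zeta k ((n * k)%:R + k%:R)
             = (1 - beta) * delta_inf + beta * incr_exp zeta k (n * k)%:R) ->
  forall n, zeta (n * k)%:R = gamma * (n * k)%:R + C * (1 - beta ^+ n).
Proof.
move=> k0 b1 z0 rec.
have kN0 : k%:R != 0 :> R by rewrite pnatr_eq0 -lt0n.
have b1N0 : 1 - beta != 0 by rewrite subr_eq0 eq_sym lt_eqF.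
have deltaE n : incr_exp zeta k (n * k)%:R
    = delta_inf + beta ^+ n * (delta0 - delta_inf).
  elim: n => [|n IH]; first by rewrite mul0n expr0 /delta0; ring.
  by rewrite mulSn natrD addrC rec IH exprS; ring.
elim=> [|n IH]; first by rewrite mul0n z0 expr0; ring.
have := deltaE n; rewrite {1}/incr_exp => /eqP.
rewrite subr_eq mulSn natrD [k%:R + _]addrC => /eqP ->.
by rewrite IH exprS /gamma /C; field; rewrite b1N0.
Qed.

End hierarchical_exponents.

(** * Legendre transform of the log-Poisson exponents *)

Lemma sing_spectrum_log_poisson {R : realType} (zeta : R -> R) (k : nat)
    (beta gamma c d h : R) :
  (0 < k)%N -> 0 < beta < 1 -> 0 <= c ->
  (forall p : R, 0 <= p ->
    zeta p = gamma * p + c * (1 - beta `^ (p / k%:R))) ->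
  gamma <= h <= gamma + c / k%:R * `|ln beta| ->
  let x := k%:R * (h - gamma) / (c * `|ln beta|) in
  sing_spectrum zeta d h = d - c + c * x * (1 - ln x).
Proof.
move=> k0 b01 c0 zetaE /andP[h1 h2] x.
have [b0 b1] := andP b01.
have kN0 : 0 < k%:R :> R by rewrite ltr0n.
have lb0 : 0 < `|ln beta| by rewrite normr_gt0 lt_eqF// ln_lt0.
have lbE : ln beta = - `|ln beta| by rewrite ltr0_norm ?opprK// ln_lt0.
set L := `|ln beta| in lb0 lbE h2 x *.
have hx : h - gamma = c * L * x / k%:R.
  (* For [c = 0] the range of [h] shrinks to [gamma] and both sides vanish. *)
  have [c_eq0|cN0] := eqVneq c 0.
    have -> : h = gamma by apply/eqP; rewrite eq_le h1 (le_trans h2)// c_eq0; lra.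
    by rewrite c_eq0; ring.
  by rewrite /x; field; rewrite !gt_eqF// lt_def cN0.
have x0 : 0 <= x.
  by apply: divr_ge0; apply: mulr_ge0; rewrite ?subr_ge0// ltW.
(* The upper end of the range of [h], in a form that also holds for [c = 0]; it gives [x <= 1] once
   [c > 0]. *)
have cx1 : c * x <= c.
  rewrite -(ler_pM2r lb0) -(ler_pM2r (_ : 0 < k%:R^-1)) ?invr_gt0//.
  have -> : c * x * L / k%:R = h - gamma by rewrite hx; ring.
  by rewrite lerBlDl (le_trans h2)// lerD2l mulrAC.
(* Substituting [p = s k / L], the function to minimise over [s >= 0] becomes
   [d - c + c (x s + exp (- s))], whose critical point is [s = - ln x]; for
   [x = 0] the infimum is only reached as [s] tends to infinity. *)
pose S := [set p * h - zeta p + d | p in [set p : R | 0 <= p]].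
have valE s : 0 <= s ->
    s * k%:R / L * h - zeta (s * k%:R / L) + d = d - c + c * (x * s + expR (- s)).
  move=> s0; have p0 : 0 <= s * k%:R / L.
    by rewrite !mulr_ge0// ?invr_ge0 ltW.
  rewrite zetaE// /powR gt_eqF// lbE.
  have -> : s * k%:R / L / k%:R * - L = - s by field; rewrite !gt_eqF.
  have -> : h = gamma + c * L * x / k%:R by rewrite -hx; ring.
  by field; rewrite !gt_eqF.
have lbS : lbound S (d - c + c * x * (1 - ln x)).
  move=> _ [p /= p0 <-].
  have s0 : 0 <= p * L / k%:R by rewrite !mulr_ge0// ?invr_ge0 ltW.
  have -> : p = (p * L / k%:R) * k%:R / L by field; rewrite !gt_eqF.
  rewrite valE// lerD2l -mulrA ler_wpM2l//.
  set s := _ / _.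
  move: x0; rewrite le_eqVlt => /predU1P[<-|x_gt0].
    by rewrite !mul0r add0r expR_ge0.
  (* Tangent line at the critical point: [expR (- s) = x * expR (- s - ln x) >= x * (1 - s - ln
     x)]. *)
  have -> : - s = ln x + (- s - ln x) by ring.
  rewrite expRD lnK// -mulrDr ler_pM2l//.
  by have := expR_ge1Dx (- s - ln x); lra.
have S0 : S !=set0 by exists (0 * h - zeta 0 + d), 0 => /=.
apply/eqP; rewrite eq_le; apply/andP; split; last exact: lb_le_inf.
have hlb : has_lbound S by exists (d - c + c * x * (1 - ln x)).
have infle s : 0 <= s -> inf S <= d - c + c * (x * s + expR (- s)).
  move=> s0; rewrite -valE//; apply: ge_inf => //; exists (s * k%:R / L) => //=.
  by rewrite !mulr_ge0// ?invr_ge0 ltW.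
have [c_le0|c_gt0] := leP c 0.
  have c_eq0 : 0 = c by apply/eqP; rewrite eq_le c0.
  by apply: le_trans (infle 0 (lexx _)) _; rewrite -c_eq0; lra.
have [x_le0|x_gt0] := leP x 0; last first.
  have x1 : x <= 1 by rewrite -(ler_pM2l c_gt0) mulr1.
  have := infle (- ln x); rewrite oppr_ge0 ln_le0// opprK lnK// => /(_ isT).
  by move/le_trans; apply; lra.
have x_eq0 : 0 = x by apply/eqP; rewrite eq_le x0.
rewrite -x_eq0; apply/ler_addgt0Pr => e e0.
(* With [s = c / e], [expR s >= 1 + s >= c / e] makes [c * expR (- s)] at most [e]. *)
have s0 : 0 <= c / e by rewrite divr_ge0// ltW.
apply: le_trans (infle _ s0) _; rewrite -x_eq0 mulr0 !mul0r add0r addr0 lerD2l.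
rewrite expRN ler_pdivrMr ?expR_gt0// mulrC -ler_pdivrMr//.
by apply: le_trans (expR_ge1Dx _); rewrite lerDr.
Qed.


(** * From the cascade moments to law, exponents and spectrum *)

Theorem mainTheorem1 (d0 : measure_display) (T : measurableType d0)
  (R : realType) (P : probability T R) (W : {RV P >-> R})
  (r : R) (k : nat) (zeta : R -> R) (beta delta_inf : R) (dim : nat) :
  0 < r < 1 -> (0 < k)%N ->
  (forall t, 0 < W t) ->
  ('E_P[W] = 1)%E ->
  (forall p : R, 0 <= p -> ('E_P[fun t => (W t `^ p)%R] = (r `^ zeta p)%:E)%E) ->
  0 < beta < 1 ->
  (incr_exp zeta k p @[p --> +oo] --> delta_inf) ->
  (forall n : nat, incr_exp zeta k ((n * k)%:R + k%:R)
                   = (1 - beta) * delta_inf + beta * incr_exp zeta k (n * k)%:R) ->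
  let gamma := delta_inf / k%:R in
  let C := (incr_exp zeta k 0 - delta_inf) / (1 - beta) in
  [/\ (forall p : R, 0 <= p -> zeta p = gamma * p + C * (1 - beta `^ (p / k%:R))),
      (let a := gamma * ln r in
       let b := ln beta / k%:R in
       let lambda := - C * ln r in
       0 <= lambda /\
       forall A : set R, measurable A ->
         P ((fun t => ln (W t)) @^-1` A)
         = poisson_prob lambda 0%N [set n : nat | A (a + b * n%:R)])
    & (forall h : R, gamma <= h <= gamma + C / k%:R * `|ln beta| ->
       let x := k%:R * (h - gamma) / (C * `|ln beta|) in
       sing_spectrum zeta dim%:R h = dim%:R - C + C * x * (1 - ln x))].
Proof.
move=> r01 k0 W0 _ momentW b01 _ rec gamma C.
have [r0 _] := andP r01; have [b0 b1] := andP b01.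
have lnr : ln r < 0 by exact: ln_lt0.
have lnb : ln beta < 0 by exact: ln_lt0.
have kN0 : k%:R != 0 :> R by rewrite pnatr_eq0 -lt0n.
pose a := gamma * ln r; pose b := ln beta / k%:R; pose l := - C * ln r.
have mWE p : 0 <= p ->
    (\int[P]_t (expR (p * ln (W t)))%:E = (expR (zeta p * ln r))%:E)%E.
  move=> p0; have := momentW p p0; rewrite unlock /powR (gt_eqF r0) => <-.
  by apply: eq_integral => t _; rewrite gt_eqF.
have zeta0 : zeta 0 = 0.
  have := mWE 0 (lexx _); under eq_integral do rewrite mul0r expR0.
  rewrite integral_cst//= probability_setT mule1 => -[] /esym/eqP.
  rewrite -[X in _ == X]expR0 (inj_eq (@expR_inj _)) mulf_eq0 (lt_eqF lnr) orbF.
  by move/eqP.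
have zetaE := hierarchical_exponents_lattice _ _ _ _ k0 b1 zeta0 rec.
have mlnW : measurable_fun setT (fun t => ln (W t)).
  exact: measurableT_comp.
(* Normalised so that [V = beta ^+ j] exactly when [ln W = a + b * j]; subtracting [a] cancels the
   linear part of [zeta] in the moments. *)
pose V t := expR (k%:R * (ln (W t) - a)).
have mV : measurable_fun setT V.
  by apply: measurableT_comp => //; apply: measurable_funM => //; exact: measurable_funB.
have V0 t : 0 <= V t by exact: expR_ge0.
have momentV n : (\int[P]_t (V t ^+ n)%:E = (expR (- l * (1 - beta ^+ n)))%:E)%E.
  have -> : expR (- l * (1 - beta ^+ n)) =
      expR (- (a * (n * k)%:R)) * expR (zeta (n * k)%:R * ln r).
    by rewrite -expRD zetaE; congr expR; rewrite /l /a /gamma /C; ring.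
  rewrite EFinM -mWE// -ge0_integralZl_EFin//; last first.
    by apply/measurable_EFinP; apply: measurableT_comp => //; exact: measurable_funM.
  apply: eq_integral => t _; rewrite -EFinM -expRD /V -expRM_natl natrM.
  by congr (expR _)%:E; ring.
have l0 : 0 <= l := poisson_moments_ge0 _ _ _ _ _ _ _ mV V0 b01 momentV.
have atoms j : P [set t | ln (W t) = a + b * j%:R] = (exp_coeff l j * expR (- l))%:E.
  rewrite -(poisson_moments_atom _ _ _ _ _ _ _ mV V0 b01 momentV).
  congr (P _); apply/seteqP; split => t /=; rewrite /V -[beta in beta ^+ _]lnK// -expRM_natl.
    by move=> ->; congr expR; rewrite /b; field.
  move/expR_inj => e; apply: (mulfI kN0); rewrite mulrDr -[LHS](subrK (k%:R * a)) -mulrBr e.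
  by rewrite /b; field.
have x_inj : injective (fun j : nat => a + b * j%:R).
  move=> i j /addrI/mulfI ij; apply/eqP; rewrite -(eqr_nat R); apply/eqP/ij.
  by rewrite mulf_neq0// ?invr_eq0// lt_eqF.
have sum1 : (\sum_(0 <= j <oo) (exp_coeff l j * expR (- l))%:E = 1)%E.
  under eq_eseriesr do rewrite mulrC EFinM.
  rewrite nneseriesZl; last by move=> j _; rewrite lee_fin exp_coeff_ge0.
  by rewrite nneseries_exp_coeff// -EFinM -expRD addNr expR0.
have C0 : 0 <= C by move: l0; rewrite /l mulNr oppr_ge0 nmulr_lle0.
have zeta_all p : 0 <= p -> zeta p = gamma * p + C * (1 - beta `^ (p / k%:R)).
  move=> p0; have := ge0_integral_discrete_law _ _ _ _ _ _ _ mlnW x_inj atoms sum1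
    (fun y => expR (p * y)).
  rewrite mWE// => /(_ _ (fun y => expR_ge0 _)) /wrap[].
    by apply: measurableT_comp => //; exact: measurable_funM.
  have lB0 : 0 <= l * beta `^ (p / k%:R) by rewrite mulr_ge0// powR_ge0.
  have powE : beta `^ (p / k%:R) = expR (p / k%:R * ln beta).
    by rewrite /powR gt_eqF.
  have term j : expR (p * (a + b * j%:R)) * (exp_coeff l j * expR (- l)) =
      expR (p * a - l) * exp_coeff (l * beta `^ (p / k%:R)) j.
    have -> : p * (a + b * j%:R) = p * a + p / k%:R * ln beta * j%:R.
      by rewrite /b; ring.
    rewrite !expRD expRM_natr -powE /exp_coeff/= [(l * _) ^+ j]exprMn.
    by ring.
  under eq_eseriesr do rewrite term EFinM.
  rewrite nneseriesZl; last by move=> j _; rewrite lee_fin exp_coeff_ge0.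
  rewrite nneseries_exp_coeff// -EFinM -expRD => -[] /expR_inj zE.
  apply: (@mulIf _ (ln r)); first by rewrite lt_eqF.
  rewrite zE /l /a.
  by ring.
split => //.
- split => // A mA.
  by rewrite (discrete_law _ _ _ _ _ _ _ mlnW x_inj atoms sum1)// poisson_prob_series.
- move=> h; exact: sing_spectrum_log_poisson.
Qed.
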